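(* Let $n\ge 1$ and let $f\in C^1(\mathbb R^n)$ be real-valued. Let $G_f=\{\nabla f(x):x\in\mathbb R^n\}$ and $$A_\infty(f)=\bigcap_{R>0}\overline{\{\nabla f(x): x\in\mathbb R^n,\ |x|\ge R\}}.$$ Then $$\overline{G_f}=\overline{\operatorname{int} G_f}\cup A_\infty(f).$$
   Context: The interior and closure of subsets of $\mathbb R^n$ are taken in the Euclidean topology, and $|\cdot|$ is the Euclidean norm. The set $A_\infty(f)$ is the set of asymptotic values of the gradient map: $p\in A_\infty(f)$ exactly when there is a sequence $(x_k)$ with $|x_k|\to\infty$ and $\nabla f(x_k)\to p$. It may be empty. No assumption on the support or growth of $f$ is made. *)

(* Defs.v *)
From mathcomp Require Import all_boot all_order all_algebra.
From mathcomp Require Import all_classical all_reals all_analysis.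
Set Implicit Arguments.
Unset Strict Implicit.
Unset Printing Implicit Defensive.
Import Order.TTheory GRing.Theory Num.Theory.
Import numFieldNormedType.Exports.

Local Open Scope classical_set_scope.
Local Open Scope ring_scope.

(* The library norm on 'rV[R]_n is the sup norm. It induces the Euclidean
   topology, so the library's closure, interior, continuity and
   differentiability are the Euclidean ones, but the norm itself differs. *)
Definition eucl_norm (R : realType) (n : nat) (x : 'rV[R]_n) : R :=
  Num.sqrt (\sum_(i < n) x ord0 i ^+ 2).

Definition gradient (R : realType) (n : nat) (f : 'rV[R]_n -> R)
    (x : 'rV[R]_n) : 'rV[R]_n :=
  \row_(i < n) 'D_(delta_mx ord0 i) f x.

Definition is_C1 (R : realType) (n : nat) (f : 'rV[R]_n -> R) : Prop :=
  (forall x, differentiable f x) /\ continuous (gradient f).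

Definition gradient_range (R : realType) (n : nat) (f : 'rV[R]_n -> R) :
    set 'rV[R]_n :=
  range (gradient f).

Definition asymptotic_values (R : realType) (n : nat) (f : 'rV[R]_n -> R) :
    set 'rV[R]_n :=
  \bigcap_(r in [set r : R | 0 < r])
    closure (gradient f @` [set x | r <= eucl_norm x]).

(* Main.v *)
Require Import Defs.
From mathcomp Require Import all_boot all_order all_algebra.
From mathcomp Require Import all_classical all_reals all_analysis.
From mathcomp Require Import ring lra zify.
Import Order.TTheory GRing.Theory Num.Theory.
Import numFieldNormedType.Exports.

(** Only the inclusion from left to right has content. Write [g] for the
    gradient of [f], and suppose that a value [p] in the closure of the gradient
    range is neither asymptotic nor in the closure of the interior. Some
    gradient [g x0] is close to [p]; subtracting a linear function and
    translating, assume [x0 = 0] and [g 0 = 0]. Then [|g| >= eps] outside a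
    bounded set, since [p] is not asymptotic, and the values omitted by [g] are
    dense near 0.

    If [a] is small and omitted, then [f - dot a] has no critical point, and
    its gradient is even bounded below. One can therefore slide down the graph
    of [f - dot a] from any point and lose a prescribed height, while staying
    in a bounded region that does not depend on [a] ([phase_exists]).

    The contradiction comes from doing this with the linear function as a
    parameter. The function [(x, q) |-> f x - dot q x] is constant on the set
    [x = 0], and it has a saddle-like critical point at [(0, 0)] which no
    degeneracy of [f] can remove. Cover a small cube of parameters [q] by a
    fine grid, pick an omitted value [a i] near each node, and starting from 0
    slide down the functions [f - dot (a i)] one after the other, each for a
    time given by a bump function of [q] around its node. This reaches a point
    [X q] that depends continuously on [q]. At each [q] a bounded number of
    phases is active, and replacing [a i] by [q] in an active phase costs at most
    [|a i - q|] times the size of the bounded region; for a fine grid the loss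
    of height prevails, and [f (X q) - dot q (X q) < f 0] ([chain_energy]).
    So [X] has no zero. On the other hand, where [q j] is extremal in the cube,
    [q] dominates [g] near 0, so that sliding for a short time moves the [j]-th
    coordinate towards the sign of [q j] ([chain_local]). By the theorem of
    Poincare and Miranda, [X] has a zero.

    The latter theorem, equivalent to that of Brouwer, is derived from a
    statement on labelled grids ([grid_miranda]), which is Stokes' formula for
    a product of coboundaries modulo 2. *)

Set Implicit Arguments.
Unset Strict Implicit.
Unset Printing Implicit Defensive.

Local Open Scope ring_scope.

(** * Labelled grids *)

Section Grid.
Variable n : nat.
Notation point := {ffun 'I_n -> nat}.
Notation label := (point -> 'F_2).

Definition unit_shift (d : 'I_n) (v : point) : point :=
  [ffun j => (v j + (j == d))%N].

(** The cubical (Serre) cup product of the coboundaries of the labels [Fs],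
    modulo 2, evaluated on the cube with lowest vertex [v] and directions [D]:
    the sum over all monotone edge paths through the cube of the products of
    the increments of the labels along the path, one label per edge. The
    recursion on the first edge replaces a sum over permutations. *)
Fixpoint cup (Fs : seq label) (D : {set 'I_n}) (v : point) : 'F_2 :=
  if Fs is F :: Gs then
    \sum_(d in D) (F (unit_shift d v) + F v) * cup Gs (D :\ d) (unit_shift d v)
  else 1.

Definition cell (D : {set 'I_n}) (v z : point) : Prop :=
  forall j, (v j <= z j <= v j + (j \in D))%N.

Lemma addF2 (x : 'F_2) : x + x = 0.
Proof. by case: x => -[|[|[]]] //= i; apply: val_inj. Qed.

Lemma addF2_inj (x y : 'F_2) : x + y = 0 -> x = y.
Proof. by move=> xy; rewrite -[x]addr0 -(addF2 y) addrA xy add0r. Qed.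

Lemma addF2_eq0 (x y : 'F_2) : x = y -> x + y = 0.
Proof. by move->; apply: addF2. Qed.

Lemma shiftC d e v : unit_shift d (unit_shift e v) = unit_shift e (unit_shift d v).
Proof. by apply/ffunP => j; rewrite !ffunE addnAC. Qed.

(** Symmetric terms pair up, and each pair vanishes modulo 2. *)
Lemma sum_offdiag_sym (D : {set 'I_n}) (A : 'I_n -> 'I_n -> 'F_2) :
  (forall d e, A d e = A e d) -> \sum_(d in D) \sum_(e in D :\ d) A d e = 0.
Proof.
move=> Asym.
rewrite (eq_bigr (fun d : 'I_n => \sum_(e in D | e != d) A d e)); last first.
  by move=> d _; apply: eq_bigl => e; rewrite !inE andbC.
rewrite pair_big_dep /=.
rewrite (bigID (fun p : 'I_n * 'I_n => (p.1 < p.2)%N)) /=.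
apply: addF2_eq0.
have swapK : involutive (fun p : 'I_n * 'I_n => (p.2, p.1)) by case.
rewrite (reindex_inj (inv_inj swapK)) /=.
apply: eq_big => [[d e]|[d e] _] /=; last exact: Asym.
rewrite -(inj_eq val_inj) -(inj_eq val_inj e) /=; lia.
Qed.

Lemma sum_offdiagC (D : {set 'I_n}) (A : 'I_n -> 'I_n -> 'F_2) :
  \sum_(d in D) \sum_(e in D :\ d) A d e = \sum_(d in D) \sum_(e in D :\ d) A e d.
Proof.
rewrite (exchange_big_dep [in D]) /=; last by move=> d e _; rewrite !inE => /andP[].
apply: eq_bigr => d dD; apply: eq_bigl => e; rewrite !inE dD andbT eq_sym; exact: andbC.
Qed.

(** A product of coboundaries is a cocycle, so its sum over the facets of a
    cube vanishes; each direction [d] contributes two opposite facets. *)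
Lemma cup_closed (Fs : seq label) (D : {set 'I_n}) (v : point) :
  \sum_(d in D) (cup Fs (D :\ d) (unit_shift d v) + cup Fs (D :\ d) v) = 0.
Proof.
elim: Fs D v => [|F Gs IH] D v /=.
  by apply: big1 => d _; rewrite addF2.
pose c := cup Gs.
have setDC d e : D :\ d :\ e = D :\ e :\ d by rewrite !finset.setDDl finset.setUC.
rewrite big_split /=.
have -> : \sum_(d in D) \sum_(e in D :\ d)
    (F (unit_shift e (unit_shift d v)) + F (unit_shift d v)) *
      c (D :\ d :\ e) (unit_shift e (unit_shift d v))
  = \sum_(d in D) F (unit_shift d v) * \sum_(e in D :\ d) c (D :\ d :\ e) (unit_shift d v).
  transitivity (\sum_(d in D) \sum_(e in D :\ d)
       F (unit_shift e (unit_shift d v)) * c (D :\ d :\ e) (unit_shift e (unit_shift d v))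
    + \sum_(d in D) F (unit_shift d v) *
        \sum_(e in D :\ d) c (D :\ d :\ e) (unit_shift e (unit_shift d v))).
    rewrite -big_split; apply: eq_bigr => d _.
    by rewrite mulr_sumr -big_split; apply: eq_bigr => e _; rewrite mulrDl.
  rewrite sum_offdiag_sym ?add0r; last by move=> d e; rewrite shiftC setDC.
  apply: eq_bigr => d _; congr (_ * _); apply: addF2_inj.
  by rewrite -big_split; apply: IH.
have -> : \sum_(d in D) \sum_(e in D :\ d)
    (F (unit_shift e v) + F v) * c (D :\ d :\ e) (unit_shift e v)
  = \sum_(d in D) F (unit_shift d v) * \sum_(e in D :\ d) c (D :\ d :\ e) (unit_shift d v).
  transitivity (\sum_(d in D) \sum_(e in D :\ d)
       F (unit_shift e v) * c (D :\ d :\ e) (unit_shift e v)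
    + F v * \sum_(d in D) \sum_(e in D :\ d) c (D :\ d :\ e) (unit_shift e v)).
    rewrite mulr_sumr -big_split; apply: eq_bigr => d _.
    by rewrite mulr_sumr -big_split; apply: eq_bigr => e _; rewrite mulrDl.
  have -> : \sum_(d in D) \sum_(e in D :\ d) c (D :\ d :\ e) (unit_shift e v) = 0.
    transitivity (\sum_(d in D) \sum_(e in D :\ d) c (D :\ d :\ e) v).
      apply: eq_bigr => d _; apply: addF2_inj.
      by rewrite -big_split; apply: IH.
    by apply: sum_offdiag_sym => d e; rewrite setDC.
  rewrite mulr0 addr0 sum_offdiagC; apply: eq_bigr => d _.
  by rewrite mulr_sumr; apply: eq_bigr => e _; rewrite setDC.
exact: addF2.
Qed.

(** Each nonzero path uses every label on one of its edges, where that label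
    must change. The contrapositive is used too: the product vanishes as soon
    as one label is constant on the cube. *)
Lemma cup_neq0 (Fs : seq label) (D : {set 'I_n}) (v : point) :
  cup Fs D v != 0 -> forall F, List.In F Fs ->
  exists z z', [/\ cell D v z, cell D v z' & F z != F z'].
Proof.
elim: Fs D v => [//|G Gs IH] D v /= nz F.
have [d dD] : exists2 d, d \in D &
    (G (unit_shift d v) + G v) * cup Gs (D :\ d) (unit_shift d v) != 0.
  apply/exists_inP; apply: contraNT nz; rewrite negb_exists_in => /forall_inP H.
  by apply/eqP; apply: big1 => d /H; rewrite negbK => /eqP.
rewrite mulf_eq0 negb_or => /andP[nzG nzc] [<-|FGs].
  exists (unit_shift d v), v; split.
  - move=> j; rewrite ffunE; case: eqVneq => [->|_]; first by rewrite dD leq_addr leqnn.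
    by rewrite addn0 leqnn leq_addr.
  - by move=> j; rewrite leqnn leq_addr.
  - by apply: contraNN nzG => /eqP ->; rewrite addF2.
have [z [z' [cz cz' zz']]] := IH _ _ nzc _ FGs.
have sub y : cell (D :\ d) (unit_shift d v) y -> cell D v y.
  move=> cy j; move: (cy j); rewrite !ffunE !inE; case: eqVneq => [->|_] /=;
    rewrite ?dD ?addn0 //.
  by move=> /andP[le1 le2]; rewrite (leq_trans _ le1) ?leq_addr.
by exists z, z'; split=> //; apply: sub.
Qed.


Section Total.
Variable m : nat.
Notation index := {ffun 'I_n -> 'I_m.+1}.

(** The cubes of a grid of [m.+1] cubes per direction are indexed by [index].
    Induction on the dimension passes to the upper facets of the grid: for the
    directions outside [D] the index is pinned to its last value, and
    [corner] moves these coordinates to the upper end [m.+1]. *)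
Definition facet (D : {set 'I_n}) (v : index) : bool :=
  [forall j, (j \notin D) ==> (v j == ord_max)].

Definition corner (D : {set 'I_n}) (v : index) : point :=
  [ffun j => (v j + (j \notin D))%N].

Definition rot_index (d : 'I_n) (v : index) : index :=
  [ffun j => if j == d then ordS (v j) else v j].

Lemma rot_index_inj d : injective (rot_index d).
Proof.
move=> v w /ffunP vw; apply/ffunP => j; have := vw j; rewrite !ffunE.
by case: eqP => // _ /(can_inj (@ordSK _)).
Qed.

Lemma facet_rot (D : {set 'I_n}) d (v : index) :
  d \in D -> facet D (rot_index d v) = facet D v.
Proof.
move=> dD; apply: eq_forallb => j; rewrite ffunE.
by case: (j =P d) => // ->; rewrite dD.
Qed.

(** Stokes in one direction: the cyclic unit_shift of the index in direction [d]
    matches the upper facet of every cube with the lower facet of the next one,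
    which leaves the two extreme facets of the grid. *)
Lemma sum_telescope (D : {set 'I_n}) d (g : label) : d \in D ->
  (forall z : point, z d = 0%N -> g z = 0) ->
  \sum_(v | facet D v) (g (unit_shift d (corner D v)) + g (corner D v))
  = \sum_(v | facet (D :\ d) v) g (corner (D :\ d) v).
Proof.
move=> dD g0; rewrite big_split /= [X in _ + X](reindex_inj (@rot_index_inj d)) /=.
rewrite [X in _ + X](eq_bigl (facet D)); last by move=> v; rewrite facet_rot.
rewrite -big_split /= (bigID (fun v : index => v d == ord_max)) /=.
rewrite [X in _ + X]big1 ?addr0; last first.
  move=> v /andP[_ vd]; apply: addF2_eq0; congr g; apply/ffunP => j; rewrite !ffunE.
  case: eqVneq => [->|_]; rewrite ?addn0 // dD !addn0 /= modn_small ?addn1 //.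
  by rewrite ltnS ltn_neqAle -(inj_eq val_inj) in vd *; rewrite vd /= -ltnS ltn_ord.
apply: eq_big => v.
  apply/andP/forallP => [[/forallP vD vd] j|vD]; last split.
  - by rewrite !inE; case: eqVneq => [->//|_] /=; apply: vD.
  - apply/forallP => j; have := vD j; rewrite !inE negb_and.
    by case: (j \in D); rewrite ?orbT.
  - by have := vD d; rewrite !inE eqxx.
move=> /andP[_ /eqP vd]; rewrite [X in _ + X]g0; last first.
  by rewrite !ffunE eqxx vd dD /= modnn.
rewrite addr0; congr g; apply/ffunP => j; rewrite !ffunE !inE.
by case: eqVneq => [->|_] /=; rewrite ?dD ?addn0.
Qed.

Lemma sum_telescope0 (D : {set 'I_n}) d (g : label) : d \in D ->
  (forall z : point, z d = 0%N \/ z d = m.+1 -> g z = 0) ->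
  \sum_(v | facet D v) (g (unit_shift d (corner D v)) + g (corner D v)) = 0.
Proof.
move=> dD g0; rewrite sum_telescope // => [|z zd]; last by apply: g0; left.
apply: big1 => v /forallP vd; apply: g0; right.
by have := vd d; rewrite !ffunE !inE eqxx /= => /eqP ->; rewrite addn1.
Qed.

(** By induction on the dimension. The cocycle property moves the first label
    out of the product, and the sum becomes a boundary sum. The facets
    transversal to another direction [d] contribute nothing, as [F d] is
    constant on them; on the two facets transversal to [i] the label [F i] is
    0 and 1, which leaves the same sum in one dimension less. *)
Lemma sum_cup (F : 'I_n -> label) (js : seq 'I_n) :
  (forall j (z : point), z j = 0%N -> F j z = 0) ->
  (forall j (z : point), z j = m.+1 -> F j z = 1) ->
  uniq js ->
  \sum_(v | facet [set j in js] v)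
    cup (map F js) [set j in js] (corner [set j in js] v) = 1.
Proof.
move=> F0 F1; elim: js => [_|i js IH] /=.
  rewrite (big_pred1 [ffun=> ord_max]) // => v.
  apply/forallP/eqP => [vmax|-> j]; last by rewrite ffunE eqxx implybT.
  by apply/ffunP => j; rewrite ffunE; apply/eqP; have := vmax j; rewrite inE.
move=> /andP[ijs ujs]; set D := [set j in _ :: _].
have Di : D :\ i = [set j in js].
  by apply/finset.setP => j; rewrite !inE; case: eqVneq => [->|]; rewrite ?(negPf ijs).
have iD : i \in D by rewrite !inE eqxx.
pose g d z := F i z * cup (map F js) (D :\ d) z.
transitivity (\sum_(d in D) \sum_(v | facet D v)
    (g d (unit_shift d (corner D v)) + g d (corner D v))).
  rewrite [RHS]exchange_big; apply: eq_bigr => v _.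
  transitivity (\sum_(d in D) (g d (unit_shift d (corner D v)) +
    F i (corner D v) * cup (map F js) (D :\ d) (unit_shift d (corner D v)))).
    by apply: eq_bigr => d _; rewrite mulrDl.
  rewrite !big_split; congr (_ + _); rewrite -!mulr_sumr; congr (_ * _).
  by apply: addF2_inj; rewrite -big_split; apply: cup_closed.
rewrite (bigD1 i) //= sum_telescope // => [|z zi]; last by rewrite /g F0 ?mul0r.
rewrite [X in _ + X]big1 ?addr0 => [|d /andP[dD di]].
  rewrite Di -[RHS](IH ujs); apply: eq_bigr => v /forallP vi.
  rewrite /g Di F1 ?mul1r // ffunE inE ijs.
  by have := vi i; rewrite inE ijs /= => /eqP ->; rewrite addn1.
apply: sum_telescope0 => // z zd; rewrite /g.
have djs : d \in js by move: dD; rewrite !inE (negPf di).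
have -> : cup (map F js) (D :\ d) z = 0; last by rewrite mulr0.
apply/eqP; apply: contraT => /cup_neq0 /(_ (F d)) [].
  elim: js djs {IH ijs ujs D Di iD g dD} => //= j js IH.
  by rewrite inE => /predU1P[->|/IH]; [left|right].
have eqd (y : point) : cell (D :\ d) z y -> y d = z d.
  move=> /(_ d); rewrite !inE eqxx addn0 /= => /andP[? ?].
  by apply/eqP; rewrite eqn_leq; apply/andP.
move=> y [y' [/eqd yd /eqd yd']].
by case: zd yd yd' => -> yd yd';
  rewrite ?(F0 _ _ yd) ?(F0 _ _ yd') ?(F1 _ _ yd) ?(F1 _ _ yd') eqxx.
Qed.

(** The labels cannot be separated: the total of [sum_cup] is odd, so it has a
    nonzero term. *)
Theorem grid_miranda (F : 'I_n -> point -> bool) :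
  (forall j (z : point), z j = 0%N -> F j z = false) ->
  (forall j (z : point), z j = m.+1 -> F j z) ->
  exists v : index, forall j, exists z z' : point,
  [/\ (forall i, v i <= z i <= (v i).+1)%N,
     (forall i, v i <= z' i <= (v i).+1)%N, F j z & ~~ F j z'].
Proof.
move=> F0 F1; pose G j z : 'F_2 := (F j z)%:R.
have := @sum_cup G (enum 'I_n) _ _ (enum_uniq _).
have G0 j (z : point) : z j = 0%N -> G j z = 0 by move=> zj; rewrite /G F0.
have G1 j (z : point) : z j = m.+1 -> G j z = 1 by move=> zj; rewrite /G F1.
move=> /(_ G0 G1).
have -> : [set j in enum 'I_n] = [set: 'I_n].
  by apply/finset.setP => j; rewrite !inE mem_enum.
move=> sum1.
have [v nz] : exists v, cup (map G (enum 'I_n)) [set: 'I_n] (corner [set: 'I_n] v) != 0.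
  apply/existsP; apply: contra_eqT sum1; rewrite negb_exists => /forallP all0.
  by rewrite big1 1?eq_sym ?oner_eq0 // => v _; apply/eqP; have := all0 v; rewrite negbK.
exists v => j.
have Gj : List.In (G j) (map G (enum 'I_n)).
  have := mem_enum 'I_n j; elim: (enum _) => //= i s IH.
  rewrite !inE => /orP[/eqP->|js]; [by left|right].
  by apply: IH; rewrite js inE.
have [z [z' [cz cz']]] := cup_neq0 nz Gj.
have box (y : point) : cell [set: 'I_n] (corner [set: 'I_n] v) y ->
    forall i, (v i <= y i <= (v i).+1)%N.
  by move=> cy i; have := cy i; rewrite !ffunE !inE addn0 addn1.
rewrite /G; case Fz: (F j z); case Fz': (F j z') => //= _.
- by exists z, z'; split; rewrite ?Fz'//; apply: box.
- by exists z', z; split; rewrite ?Fz//; apply: box.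
Qed.
End Total.
End Grid.

Local Open Scope classical_set_scope.
Local Open Scope ring_scope.

(** * The sup norm and the scalar product *)

Section Norm.
Context {R : realType} {n : nat}.
Implicit Types a x y u v : 'rV[R]_n.

Lemma coord_le_norm x j : `|x 0 j| <= `|x|.
Proof.
rewrite [leRHS]/Num.Def.normr /= mx_normrE.
exact: (le_bigmax _ (fun ij : 'I_1 * 'I_n => `|x ij.1 ij.2|) (0, j)).
Qed.

Lemma rV_norm_le x (a : R) : 0 <= a -> (forall j, `|x 0 j| <= a) -> `|x| <= a.
Proof.
move=> a0 xa; rewrite [leLHS]/Num.Def.normr /= mx_normrE.
by apply/bigmax_leP; split=> // -[i j] _ /=; rewrite ord1.
Qed.

Lemma rV_norm_lt x (a : R) : 0 < a -> (forall j, `|x 0 j| < a) -> `|x| < a.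
Proof.
move=> a0 xa; rewrite [ltLHS]/Num.Def.normr /= mx_normrE.
by apply/bigmax_ltP; split=> // -[i j] _ /=; rewrite ord1.
Qed.

Definition dot x y : R := \sum_j x 0 j * y 0 j.

Lemma dotDl x y u : dot (x + y) u = dot x u + dot y u.
Proof. by rewrite -big_split; apply: eq_bigr => j _; rewrite mxE mulrDl. Qed.

Lemma dotDr x y u : dot u (x + y) = dot u x + dot u y.
Proof. by rewrite -big_split; apply: eq_bigr => j _; rewrite mxE mulrDr. Qed.

Lemma dotZl (k : R) x u : dot (k *: x) u = k * dot x u.
Proof. by rewrite mulr_sumr; apply: eq_bigr => j _; rewrite mxE mulrA. Qed.

Lemma dotZr (k : R) x u : dot u (k *: x) = k * dot u x.
Proof. by rewrite mulr_sumr; apply: eq_bigr => j _; rewrite mxE mulrCA. Qed.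

Lemma dotNl x u : dot (- x) u = - dot x u.
Proof. by rewrite -scaleN1r dotZl mulN1r. Qed.

Lemma dotBl x y u : dot (x - y) u = dot x u - dot y u.
Proof. by rewrite dotDl dotNl. Qed.

Lemma norm_dot_le x y : `|dot x y| <= n%:R * (`|x| * `|y|).
Proof.
apply: (le_trans (ler_norm_sum _ _ _)).
rewrite mulr_natl -[X in _ *+ X]card_ord -sumr_const; apply: ler_sum => j _.
by rewrite normrM ler_pM ?coord_le_norm.
Qed.

Lemma dot_self_ge x : `|x| ^+ 2 <= dot x x.
Proof.
have d0 : 0 <= dot x x by apply: sumr_ge0 => j _; rewrite -expr2 sqr_ge0.
rewrite -(sqr_sqrtr d0) lerXn2r ?nnegrE ?sqrtr_ge0//.
apply: rV_norm_le => [|j]; first exact: sqrtr_ge0.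
rewrite -sqrtr_sqr ler_sqrt // /dot (bigD1 j) //= -expr2 lerDl.
by apply: sumr_ge0 => i _; rewrite -expr2 sqr_ge0.
Qed.

Lemma continuous_coord (T : topologicalType) (f : T -> 'rV[R]_n) j :
  continuous f -> continuous (fun t => f t 0 j).
Proof.
move=> cf t.
have := @continuous_comp _ _ _ f (fun M : 'rV[R]_n => M 0 j) t (cf t).
by apply; apply: coord_continuous.
Qed.

Lemma continuous_cstB (T : topologicalType) a (f : T -> 'rV[R]_n) :
  continuous f -> continuous (fun t => a - f t).
Proof. by move=> cf t; apply: cvgB; [exact: cvg_cst|exact: cf]. Qed.

Lemma continuous_norm (T : topologicalType) (f : T -> 'rV[R]_n) :
  continuous f -> continuous (fun t => `|f t|).
Proof. by move=> cf t; apply: cvg_norm; apply: cf. Qed.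

Lemma continuous_dot (T : topologicalType) (f g : T -> 'rV[R]_n) :
  continuous f -> continuous g -> continuous (fun t => dot (f t) (g t)).
Proof.
move=> cf cg t; apply: cvg_big => [|j _]; first exact: add_continuous.
apply: cvgM.
  exact: continuous_coord.
exact: continuous_coord.
Qed.

Lemma compact_norm_le (B : R) : compact [set x : 'rV[R]_n | `|x| <= B].
Proof.
apply: bounded_closed_compact.
  by exists B; split; [exact: num_real|move=> M BM x /= xB; apply/ltW/(le_lt_trans xB)].
rewrite (_ : mkset _ = (fun x : 'rV[R]_n => `|x|) @^-1` [set r : R | r <= B]) //.
apply: preimage_closed; last exact: closed_le.
by move=> x _; apply: norm_continuous.
Qed.

(** Only the first point is confined to the ball, which saves showing that
    the second one stays inside when the lemma is applied to a small step. *)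
Lemma uniformly_continuous_ball (g : 'rV[R]_n -> 'rV[R]_n) (B e : R) :
  continuous g -> 0 < e ->
  exists2 d, 0 < d & forall x y, `|x| <= B -> `|y - x| < d -> `|g y - g x| < e.
Proof.
move=> cg e0.
have /compact_near_coveringP cov := @compact_norm_le B.
have := cov R 0^'+ (fun d x => forall y, `|y - x| < d -> `|g y - g x| < e) _.
case.
  move=> x xB /=.
  have /cvgrPdist_lt /(_ (e / 2)) := cg x; rewrite divr_gt0 // => /(_ isT).
  move=> /nbhs_ballP[r /= r0 gr].
  have gx y : `|y - x| < r -> `|g y - g x| < e / 2.
    by move=> yx; rewrite distrC; apply: gr; rewrite -ball_normE /= distrC.
  exists (ball x (r / 2), [set d : R | d < r / 2]) => /=.
    split; first exact: nbhsx_ballx (divr_gt0 _ _).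
    by apply: nbhs_right_lt; rewrite divr_gt0.
  move=> [x' d] /= [xx' dr] y yx'.
  move: xx'; rewrite -ball_normE /= distrC => xx'.
  have yx : `|y - x| < r.
    rewrite (_ : y - x = (y - x') + (x' - x)); last by rewrite addrA subrK.
    by apply: (le_lt_trans (ler_normD _ _)); lra.
  rewrite (_ : g y - g x' = (g y - g x) - (g x' - g x)); last by rewrite opprB addrA subrK.
  apply: (le_lt_trans (ler_normB _ _)).
  by have := gx _ yx; have := gx x' (ltac:(lra)); lra.
move=> r /= r0 H; exists (r / 2); first by rewrite divr_gt0.
move=> x y xB; apply: (H (r / 2)) => //=; last by rewrite divr_gt0.
by rewrite sub0r normrN gtr0_norm ?divr_gt0 // gtr_pMr // invf_lt1 // ltr1n.
Qed.

End Norm.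

(** * The theorem of Poincare and Miranda *)

(** Otherwise [|X|] has a positive minimum on the cube. On a grid fine enough
    for uniform continuity, label a node by the sign of each coordinate of [X];
    in a cell where all labels change, every coordinate of [X] is smaller than
    that minimum. *)
Theorem poincare_miranda (R : realType) (n : nat) (X : 'rV[R]_n -> 'rV[R]_n)
    (rho : R) : 0 < rho -> continuous X ->
  (forall (q : 'rV[R]_n) j, `|q| <= rho -> q 0 j = rho -> 0 <= X q 0 j) ->
  (forall (q : 'rV[R]_n) j, `|q| <= rho -> q 0 j = - rho -> X q 0 j <= 0) ->
  exists2 q : 'rV[R]_n, `|q| <= rho & X q = 0.
Proof.
move=> rho0 cX Xpos Xneg; apply: contrapT => noz.
have [|||c /set_mem /= crho cmin] :=
    @EVT_min_rV R n (fun q => `|X q|) [set q : 'rV[R]_n | `|q| <= rho].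
- by exists 0; rewrite /= normr0 ltW.
- exact: compact_norm_le.
- apply: continuous_subspaceT => q.
  exact: (continuous_comp (cX q) (@norm_continuous _ _ _)).
have eta0 : 0 < `|X c|.
  by rewrite normr_gt0; apply/negP => /eqP Xc; apply: noz; exists c.
have [d d0 Xd] := uniformly_continuous_ball rho cX eta0.
have [m md] : exists m : nat, 2 * rho / m.+1%:R < d.
  exists (Num.truncn (2 * rho / d)).
  rewrite ltr_pdivrMr ?ltr0n // [d * _]mulrC -ltr_pdivrMr //.
  exact: truncnS_gt.
pose s : R := 2 * rho / m.+1%:R.
have s0 : 0 < s by rewrite divr_gt0 ?mulr_gt0 ?ltr0n.
have sm : s * m.+1%:R = 2 * rho by rewrite divfK ?pnatr_eq0.
pose gp (z : {ffun 'I_n -> nat}) : 'rV[R]_n := \row_j (- rho + s * (z j)%:R).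
have gp_le (z : {ffun 'I_n -> nat}) : (forall j, (z j <= m.+1)%N) -> `|gp z| <= rho.
  move=> zm; apply: rV_norm_le => [|j]; first exact: ltW.
  have := zm j; rewrite -(ler_nat R) -(ler_pM2l s0) sm => zj.
  have : 0 <= s * (z j)%:R by rewrite mulr_ge0 // ltW.
  by rewrite mxE ler_norml; lra.
(* On the faces the sign conditions are weak, so the label is forced there. *)
pose F j (z : {ffun 'I_n -> nat}) :=
  (z j == m.+1) || (z j != 0%N) && (0 <= X (gp z) 0 j).
have [|j z zj|v Fv] := @grid_miranda n m F.
- by move=> j z zj; rewrite /F zj.
- by rewrite /F zj eqxx.
pose w : {ffun 'I_n -> nat} := [ffun j => v j : nat].
have wrho : `|gp w| <= rho by apply: gp_le => j; rewrite ffunE ltnW // ltn_ord.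
have near_w (z : {ffun 'I_n -> nat}) : (forall i, v i <= z i <= (v i).+1)%N ->
    `|gp z| <= rho /\ `|X (gp z) - X (gp w)| < `|X c|.
  move=> vz; split.
    by apply: gp_le => j; have /andP[_ zv] := vz j; apply: leq_trans zv (ltn_ord _).
  apply: Xd => //; apply: le_lt_trans md; apply: rV_norm_le => [|j]; first exact: ltW.
  rewrite !mxE ffunE; have /andP[] := vz j.
  rewrite -!(ler_nat R) -[(v j).+1%:R]natr1 -/s => lo hi.
  rewrite (_ : _ - _ = s * ((z j)%:R - (v j)%:R)); last by ring.
  rewrite ger0_norm ?mulr_ge0 ?subr_ge0 //; last exact: ltW.
  by rewrite ler_piMr ?(ltW s0) //; lra.
have : `|X (gp w)| < `|X c|.
  apply: rV_norm_lt => // j.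
  have [z [z' [vz vz' Fz Fz']]] := Fv j.
  have [zrho zw] := near_w z vz; have [zrho' zw'] := near_w z' vz'.
  have z1 : 0 <= X (gp z) 0 j.
    move: Fz; rewrite /F => /orP[/eqP zj|/andP[]//].
    by apply: Xpos => //; rewrite mxE zj sm; ring.
  have z2 : X (gp z') 0 j <= 0.
    move: Fz'; rewrite /F negb_or negb_and negbK => /andP[_ /orP[/eqP zj|]].
      by apply: Xneg => //; rewrite mxE zj mulr0 addr0.
    by rewrite -ltNge => /ltW.
  have := le_lt_trans (coord_le_norm _ j) zw.
  have := le_lt_trans (coord_le_norm _ j) zw'.
  by rewrite !mxE !ltr_norml; lra.
by rewrite ltNge cmin // inE.
Qed.

(** * Descent along one omitted value *)

Section Descent.
Context {R : realType} {n : nat}.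
Variables (g : 'rV[R]_n -> 'rV[R]_n).
Implicit Types (a q x y : 'rV[R]_n) (h t : R) (m : nat).

(** The descent direction of [f - dot a] when [g] is the gradient of [f],
    normalised so that one unit of time costs one unit of height. With this
    normalisation the speed is at most the inverse of [|a - g x|], hence bounded
    far away. *)
Definition descent_field a x : 'rV[R]_n :=
  (dot (a - g x) (a - g x))^-1 *: (a - g x).

Definition euler_step a h x := x + h *: descent_field a x.

(** Euler steps in place of the flow of the field, which need not be unique as
    [g] is merely continuous; finitely many steps are enough, and they are
    visibly continuous in the time and in the starting point. *)
Definition phase m a t x := iter m (euler_step a (t / m%:R)) x.

Lemma dot_self_gt0 x : x != 0 -> 0 < dot x x.
Proof.
by move=> x0; apply: lt_le_trans (dot_self_ge x); rewrite exprn_gt0 ?normr_gt0.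
Qed.

Lemma descent_field_le a x (d : R) : 0 < d -> d <= `|a - g x| ->
  `|descent_field a x| <= d^-1.
Proof.
move=> d0 dx; have w0 : 0 < `|a - g x| by apply: lt_le_trans dx.
have ww : 0 < dot (a - g x) (a - g x) by rewrite dot_self_gt0 // -normr_gt0.
rewrite normrZ gtr0_norm ?invr_gt0 // mulrC ler_pdivrMr //.
rewrite ler_pdivlMl //; apply: le_trans (dot_self_ge _).
by rewrite expr2 ler_wpM2r // ltW.
Qed.

Lemma dot_descent_field a x : a != g x -> dot (a - g x) (descent_field a x) = 1.
Proof.
by move=> ax; rewrite dotZr mulVf // gt_eqF // dot_self_gt0 // subr_eq0.
Qed.

Hypothesis cg : continuous g.

Lemma continuous_phase (T : topologicalType) m a (t : T -> R) (x : T -> 'rV[R]_n) :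
  (forall y, a != g y) -> continuous t -> continuous x ->
  continuous (fun u => phase m a (t u) (x u)).
Proof.
move=> ag ct cx.
suff H k : continuous (fun u => iter k (euler_step a (t u / m%:R)) (x u)) by apply: H.
elim: k => [//|k IH] /= u.
set y := fun u : T => _ in IH.
have cw : continuous (fun u => a - g (y u)).
  apply: continuous_cstB => z; have gy := @continuous_comp _ _ _ y g z (IH z).
  by apply: gy; apply: cg.
apply: cvgD; first exact: IH.
apply: cvgZ; first by apply: cvgM; [exact: ct|exact: cvg_cst].
apply: cvgZ; last exact: cw.
apply: cvgV; last by apply: (continuous_dot cw cw).
by rewrite gt_eqF // dot_self_gt0 // subr_eq0.
Qed.

Lemma phase0 m a x : phase m a 0 x = x.
Proof.
rewrite /phase mul0r; elim: m => //= m IH.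
by rewrite IH /euler_step scale0r addr0.
Qed.

(** Where [g] is small compared with [a], the descent direction is essentially
    [a]: a short phase moves each coordinate in which [a] is large towards the
    sign of that coordinate. *)
Lemma phase_local m a t x (rho r : R) : (0 < m)%N ->
  0 < rho -> 0 <= t -> (forall y, `|y| <= r -> `|g y| <= rho / 4) ->
  3 * rho / 4 <= `|a| -> `|x| + t * (2 / rho) <= r ->
  [/\ `|phase m a t x| <= `|x| + t * (2 / rho),
    (forall j, 3 * rho / 4 <= a 0 j -> x 0 j <= phase m a t x 0 j) &
    (forall j, a 0 j <= - (3 * rho / 4) -> phase m a t x 0 j <= x 0 j)].
Proof.
move=> m0 rho0 t0 gr ar xr.
have m0' : 0 < m%:R :> R by rewrite ltr0n.
set h := t / m%:R; have h0 : 0 <= h by rewrite divr_ge0 // ltW.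
have r0 : 0 <= 2 / rho by rewrite divr_ge0 // ltW.
suff H k : (k <= m)%N -> [/\ `|iter k (euler_step a h) x| <= `|x| + k%:R * h * (2 / rho),
    (forall j, 3 * rho / 4 <= a 0 j -> x 0 j <= iter k (euler_step a h) x 0 j) &
    (forall j, a 0 j <= - (3 * rho / 4) -> iter k (euler_step a h) x 0 j <= x 0 j)].
  by have := H m (leqnn m); rewrite /h [m%:R * _]mulrC divfK ?gt_eqF.
elim: k => [_|k IH km] /=.
  by rewrite !mul0r addr0; split.
have [yr ypos yneg] := IH (ltnW km); set y := iter k _ x in yr ypos yneg *.
have yr' : `|y| <= r.
  apply: (le_trans yr); apply: le_trans xr; rewrite lerD2l ler_wpM2r //.
  rewrite /h mulrA ler_pdivrMr // mulrC ler_wpM2l // ler_nat; exact: ltnW.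
have gy := gr y yr'.
have wy : rho / 2 <= `|a - g y| by apply: le_trans (lerB_dist _ _); lra.
have vy : `|descent_field a y| <= 2 / rho.
  by rewrite -invf_div; apply: descent_field_le => //; rewrite divr_gt0.
have w0 : 0 < `|a - g y| by apply: lt_le_trans wy; rewrite divr_gt0.
have ww : 0 < dot (a - g y) (a - g y) by rewrite dot_self_gt0 // -normr_gt0.
have gyj j : `|g y 0 j| <= rho / 4 by apply: le_trans (coord_le_norm _ _) gy.
split.
- apply: (le_trans (ler_normD _ _)); rewrite normrZ ger0_norm //.
  rewrite -[k.+1%:R]natr1 [(k%:R + 1) * h]mulrDl mul1r [(_ + h) * _]mulrDl addrA.
  apply: lerD => //.
  by rewrite ler_wpM2l.
- move=> j aj; apply: (le_trans (ypos j aj)); rewrite !mxE lerDl.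
  apply: mulr_ge0 => //; apply: mulr_ge0; first by rewrite invr_ge0 ltW.
  by have := gyj j; rewrite ler_norml; lra.
- move=> j aj; apply: le_trans (yneg j aj); rewrite !mxE gerDl.
  apply: mulr_ge0_le0 => //; apply: mulr_ge0_le0; first by rewrite invr_ge0 ltW.
  by have := gyj j; rewrite ler_norml; lra.
Qed.

Variables (f : 'rV[R]_n -> R) (eps rad : R).
Hypothesis mvt : forall x v : 'rV[R]_n, exists2 t : R, 0 <= t <= 1 &
  f (x + v) - f x = dot (g (x + t *: v)) v.
Hypotheses (eps0 : 0 < eps) (rad0 : 0 <= rad).
Hypothesis far : forall x, rad <= `|x| -> eps <= `|g x|.

(** Compactness on the ball of radius [rad], and [far] outside. *)
Lemma dist_range_gt0 a : `|a| <= eps / 2 -> (forall x, a != g x) ->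
  exists2 d, 0 < d & forall x, d <= `|a - g x|.
Proof.
move=> aeps ag.
have [|||c _ cmin] :=
    @EVT_min_rV R n (fun x => `|a - g x|) [set x : 'rV[R]_n | `|x| <= rad].
- by exists 0; rewrite /= normr0.
- exact: compact_norm_le.
- by apply: continuous_subspaceT; apply: continuous_norm; apply: continuous_cstB.
exists (Num.min `|a - g c| (eps / 2)).
  by rewrite lt_min normr_gt0 subr_eq0 ag divr_gt0.
move=> x; rewrite ge_min; have [xr|/ltW xr] := leP `|x| rad.
  by rewrite cmin // inE.
apply/orP; right; rewrite distrC; apply: le_trans (lerB_dist _ _).
by have := far xr; lra.
Qed.

(** The number of steps depends on [a] and may be huge when [a] is close to the
    range of [g], but neither the radius reached nor the height lost does:
    a point in the ball of radius [rad] makes a step of length at most 1, and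
    outside this ball the speed is at most [2 / eps]. This is what makes
    phases for different [a] comparable. *)
Lemma phase_exists a (B T : R) : `|a| <= eps / 2 -> (forall x, a != g x) ->
  0 < T -> rad + 1 <= B ->
  exists2 m, (0 < m)%N & forall t, 0 <= t <= T ->
    (forall x c, rad + 1 <= c -> `|x| <= c ->
      `|phase m a t x| <= c + t * (2 / eps)) /\
    (forall x, `|x| <= B ->
      f (phase m a t x) - dot a (phase m a t x) <= f x - dot a x - t / 2).
Proof.
move=> aeps ag T0 radB.
have [d d0 dg] := dist_range_gt0 aeps ag.
have e0 : 0 < d / (2 * n.+1%:R) by rewrite divr_gt0 // mulr_gt0 // ltr0n.
have [s s0 sg] := uniformly_continuous_ball (B + T * (2 / eps)) cg e0.
(* [u] bounds the length of one step: below 1 for the radius estimate, below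
   the modulus of continuity [s] for the energy estimate. *)
pose u := Num.min 1 s; have u0 : 0 < u by rewrite lt_min ltr01.
pose m := (Num.truncn (T / d / u)).+1.
exists m => // t /andP[t0 tT]; have m0 : 0 < m%:R :> R by rewrite ltr0n.
set h := t / m%:R; have h0 : 0 <= h by rewrite divr_ge0 // ltW.
have vd x : `|descent_field a x| <= d^-1 by apply: descent_field_le.
have hv x : `|h *: descent_field a x| < u.
  rewrite normrZ ger0_norm //; apply: (@le_lt_trans _ _ (T / m%:R * d^-1)).
    by apply: ler_pM => //; rewrite ler_wpM2r // invr_ge0 ltW.
  rewrite mulrAC ltr_pdivrMr // [u * _]mulrC -ltr_pdivrMr //; exact: truncnS_gt.
have he0 : 0 <= h * (2 / eps) by rewrite mulr_ge0 // divr_ge0 // ltW.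
have speed x c : rad + 1 <= c -> `|x| <= c -> `|euler_step a h x| <= c + h * (2 / eps).
  move=> radc xc; apply: (le_trans (ler_normD _ _)).
  have [xr|/ltW xr] := leP `|x| rad.
    by have := hv x; rewrite /u lt_min => /andP[hv1 _]; lra.
  apply: lerD => //; rewrite normrZ ger0_norm // ler_wpM2l //.
  rewrite -invf_div; apply: descent_field_le; first by rewrite divr_gt0.
  by rewrite distrC; apply: le_trans (lerB_dist _ _); have := far xr; lra.
have bound k x c : rad + 1 <= c -> `|x| <= c ->
    `|iter k (euler_step a h) x| <= c + k%:R * h * (2 / eps).
  move=> radc xc; elim: k => [|k IH] /=; first by rewrite !mul0r addr0.
  rewrite -[k.+1%:R]natr1 [(k%:R + 1) * h]mulrDl mul1r [(_ + h) * _]mulrDl addrA.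
  apply: speed => //.
  by rewrite (le_trans radc) // lerDl -mulrA mulr_ge0.
have mh : m%:R * h = t by rewrite mulrC divfK // gt_eqF.
split; first by move=> x c radc xc; have := bound m x c radc xc; rewrite mh.
(* Moving along [v] would lose exactly [h] if [g] were constant; the modulus of
   continuity was chosen so that its variation costs at most half of it. *)
have energy x : `|x| <= B + T * (2 / eps) ->
    f (euler_step a h x) - dot a (euler_step a h x) <= f x - dot a x - h / 2.
  move=> xB; rewrite /euler_step; set v := descent_field a x.
  have [p /andP[p0 p1] fx] := mvt x (h *: v).
  set y := x + p *: _ in fx.
  have yx : `|y - x| < s.
    rewrite /y addrAC subrr add0r normrZ ger0_norm //.
    apply: (@le_lt_trans _ _ `|h *: v|); first by rewrite ler_piMl.
    by have := hv x; rewrite /u lt_min => /andP[].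
  have gy := sg x y xB yx.
  have gv : `|dot (g y - g x) v| <= 2^-1.
    apply: (le_trans (norm_dot_le _ _)).
    apply: (@le_trans _ _ (n.+1%:R * (d / (2 * n.+1%:R) * d^-1))).
      apply: ler_pM; [exact: ler0n|by apply: mulr_ge0|by rewrite ler_nat|].
      by apply: ler_pM; [by []|by []|exact: ltW|exact: vd].
    rewrite le_eqVlt; apply/orP; left; apply/eqP; field.
    by rewrite (gt_eqF d0) /= nat1r pnatr_eq0.
  have key : f (x + h *: v) - dot a (x + h *: v) - (f x - dot a x)
      = h * (dot (g y - g x) v - dot (a - g x) v).
    rewrite dotDr dotZr; transitivity (f (x + h *: v) - f x - h * dot a v); first by ring.
    by rewrite fx dotZr !dotBl; ring.
  rewrite (dot_descent_field (ag x)) in key.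
  have : h * (dot (g y - g x) v - 1) <= h * - (1 / 2).
    by apply: ler_wpM2l => //; move: gv; rewrite ler_norml; lra.
  by rewrite -key; lra.
move=> x xB.
suff H k : (k <= m)%N -> f (iter k (euler_step a h) x) - dot a (iter k (euler_step a h) x)
    <= f x - dot a x - k%:R * h / 2.
  by have := H m (leqnn m); rewrite mh.
elim: k => [_|k IH km] /=; first by rewrite !mul0r subr0.
have := IH (ltnW km); set y := iter k _ x.
have yB : `|y| <= B + T * (2 / eps).
  apply: (le_trans (bound k x B radB xB)); rewrite lerD2l ler_wpM2r //.
    by rewrite divr_ge0 // ltW.
  apply: le_trans tT; rewrite -mh ler_wpM2r // ler_nat; exact: ltnW.
by have := energy y yB; rewrite -[k.+1%:R]natr1 [(k%:R + 1) * h]mulrDl mul1r; lra.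
Qed.

End Descent.

(** * Descent along the values near a grid *)

(** The multiplicity is bounded independently of the mesh: among the
    nodes within [2 * d] of one point, no two have the same residues
    modulo 4 in all coordinates. *)
Lemma grid_cover (R : realType) (n : nat) (rho s : R) : 0 < rho -> 0 < s ->
  exists (I : finType) (c : I -> 'rV[R]_n) (d : R),
  [/\ 0 < d <= s, (forall i, `|c i| <= rho),
    (forall q : 'rV[R]_n, `|q| <= rho -> exists i, `|q - c i| <= d) &
    (forall q : 'rV[R]_n, (#|[pred i | (`|q - c i| < 2 * d)%R]| <= 4 ^ n)%N)].
Proof.
move=> rho0 s0; pose m := Num.truncn (2 * rho / s).
pose d : R := 2 * rho / m.+1%:R.
have d0 : 0 < d by rewrite divr_gt0 ?mulr_gt0 ?ltr0n.
have ds : d <= s.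
  by rewrite ler_pdivrMr ?ltr0n // [s * _]mulrC -ler_pdivrMr //; apply/ltW/truncnS_gt.
have dm : d * m.+1%:R = 2 * rho by rewrite divfK ?pnatr_eq0.
pose c (k : {ffun 'I_n -> 'I_m.+2}) : 'rV[R]_n := \row_j (- rho + d * (k j)%:R).
exists {ffun 'I_n -> 'I_m.+2}, c, d; split; first by rewrite d0.
- move=> k; apply: rV_norm_le => [|j]; first exact: ltW.
  have : d * (k j)%:R <= 2 * rho by rewrite -dm ler_pM2l // ler_nat -ltnS.
  have : 0 <= d * (k j)%:R by rewrite mulr_ge0 // ltW.
  by rewrite mxE ler_norml; lra.
- move=> q qrho.
  pose z j := (q 0 j + rho) / d.
  have z0 j : 0 <= z j.
    have := le_trans (coord_le_norm q j) qrho; rewrite ler_norml => /andP[lo _].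
    by apply: divr_ge0; [lra|exact: ltW].
  have zm j : (Num.truncn (z j) < m.+2)%N.
    have := le_trans (coord_le_norm q j) qrho; rewrite ler_norml => /andP[_ hi].
    have zle : z j <= m.+1%:R by rewrite ler_pdivrMr // mulrC dm; lra.
    by rewrite ltnS -(ler_nat R); apply: le_trans zle; rewrite truncn_le.
  exists [ffun j => Ordinal (zm j)]; apply: rV_norm_le => [|j]; first exact: ltW.
  rewrite !mxE ffunE /=; have /andP[] := truncn_itv (z0 j).
  rewrite -[(_).+1%:R]natr1; set t := (Num.truncn _)%:R => tz zt.
  rewrite (_ : _ - _ = d * (z j - t)); last by rewrite /z; field; rewrite gt_eqF.
  have zt0 : 0 <= z j - t by lra.
  by rewrite normrM (gtr0_norm d0) (ger0_norm zt0) ler_piMr ?(ltW d0) //; lra.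
- move=> q; set A := [pred i | _].
  pose color (k : {ffun 'I_n -> 'I_m.+2}) : {ffun 'I_n -> 'I_4} :=
    [ffun j => inord (k j %% 4)].
  have cinj : {in A &, injective color}.
    move=> k l; rewrite !inE => qk ql /ffunP kl; apply/ffunP => j; apply: val_inj => /=.
    have := kl j; rewrite !ffunE => /(congr1 (@nat_of_ord _)).
    rewrite !inordK ?ltn_mod // => klj.
    have := le_lt_trans (coord_le_norm _ j) qk.
    have := le_lt_trans (coord_le_norm _ j) ql.
    rewrite !mxE !ltr_norml => /andP[l1 l2] /andP[k1 k2].
    have kl4 : (k j)%:R < (l j)%:R + 4 :> R by rewrite -(ltr_pM2l d0) mulrDr; lra.
    have lk4 : (l j)%:R < (k j)%:R + 4 :> R by rewrite -(ltr_pM2l d0) mulrDr; lra.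
    move: kl4 lk4 klj; rewrite -!natrD !ltr_nat.
    move: (k j : nat) (l j : nat) => u w; clear; lia.
  rewrite -(card_in_imset cinj); apply: leq_trans (max_card _) _.
  by rewrite card_ffun !card_ord.
Qed.

Section Chain.
Context {R : realType} {n : nat}.
Variables (g : 'rV[R]_n -> 'rV[R]_n) (I : Type).
Variables (m : I -> nat) (a : I -> 'rV[R]_n) (lam : I -> R).
Implicit Types (s : seq I) (x q : 'rV[R]_n).

Definition chain s x := foldl (fun y i => phase g (m i) (a i) (lam i) y) x s.

Definition total_time s : R := \sum_(i <- s) lam i.

Hypothesis lam0 : forall i, 0 <= lam i.

Lemma total_time_ge0 s : 0 <= total_time s.
Proof. by apply: sumr_ge0. Qed.

(** All vectors that are used are close to [q], so on a face of the cube of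
    radius [rho] they agree with [q] on the sign of the extremal coordinate. *)
Lemma chain_local (rho r : R) q s x : 0 < rho -> (forall i, (0 < m i)%N) ->
  (forall y, `|y| <= r -> `|g y| <= rho / 4) -> `|q| = rho ->
  (forall i, lam i != 0 -> `|a i - q| <= rho / 4) ->
  `|x| + total_time s * (2 / rho) <= r ->
  (forall j, q 0 j = rho -> x 0 j <= chain s x 0 j) /\
  (forall j, q 0 j = - rho -> chain s x 0 j <= x 0 j).
Proof.
move=> rho0 m0 gr qrho aq.
elim: s x => [|i s IH] x /=; first by move=> _; split.
rewrite /total_time big_cons -/(total_time s) mulrDl addrA => xr.
have [li|li] := eqVneq (lam i) 0.
  by rewrite li phase0; apply: IH; move: xr; rewrite li mul0r addr0.
have st0 : 0 <= total_time s * (2 / rho).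
  by rewrite mulr_ge0 ?total_time_ge0 // divr_ge0 // ltW.
have ai := aq i li.
have aij j : `|a i 0 j - q 0 j| <= rho / 4.
  by have := le_trans (coord_le_norm _ j) ai; rewrite !mxE.
have [||y1 y2 y3] :=
  @phase_local R n g (m i) (a i) (lam i) x rho r (m0 i) rho0 (lam0 i) gr.
- have := ler_normB (a i) (a i - q); rewrite opprB addrC subrK qrho; lra.
- by apply: le_trans xr; rewrite lerDl.
have [j1 j2] := IH (phase g (m i) (a i) (lam i) x) (le_trans (lerD y1 (lexx _)) xr).
split=> j qj.
- apply: le_trans (j1 j qj); apply: y2.
  by have := aij j; rewrite qj ler_norml; lra.
- apply: (le_trans (j2 j qj)); apply: y3.
  by have := aij j; rewrite qj ler_norml; lra.
Qed.

Variables (f : 'rV[R]_n -> R) (eps rad B : R).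
Hypothesis eps0 : 0 < eps.
Hypothesis radius : forall i x c, rad + 1 <= c -> `|x| <= c ->
  `|phase g (m i) (a i) (lam i) x| <= c + lam i * (2 / eps).
Hypothesis energy : forall i x, `|x| <= B ->
  f (phase g (m i) (a i) (lam i) x) - dot (a i) (phase g (m i) (a i) (lam i) x)
    <= f x - dot (a i) x - lam i / 2.

(** The phase of [a i] controls [f - dot (a i)] rather than [f - dot q]. The
    difference is the linear function [dot (a i - q)], which varies by at most
    [n * eta * (2 * B)] in the ball of radius [B], whatever the length of
    the phase. Hence the error counts the active phases only. *)
Lemma chain_energy (eta : R) q s x c :
  (forall i, lam i != 0 -> `|a i - q| <= eta) ->
  rad + 1 <= c -> `|x| <= c -> c + total_time s * (2 / eps) <= B ->
  f (chain s x) - dot q (chain s x) <= f x - dot q x - total_time s / 2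
    + \sum_(i <- s) (lam i != 0)%:R * (n%:R * (eta * (2 * B))).
Proof.
move=> aq; elim: s x c => [|i s IH] x c radc xc /=.
  by rewrite /total_time !big_nil; lra.
rewrite /total_time !big_cons -/(total_time s) mulrDl addrA => cB.
have [li|li] := eqVneq (lam i) 0.
  rewrite li phase0 mul0r !add0r; apply: (IH x c) => //.
  by move: cB; rewrite li mul0r addr0.
have e0 : 0 < 2 / eps by rewrite divr_gt0.
have li0 : 0 <= lam i * (2 / eps) by rewrite mulr_ge0 // ltW.
have s0 : 0 <= total_time s * (2 / eps) by rewrite mulr_ge0 ?total_time_ge0 // ltW.
set y := phase _ _ _ _ x.
have yc : `|y| <= c + lam i * (2 / eps) by apply: radius.
have := IH y (c + lam i * (2 / eps)) _ yc cB; rewrite -/(chain s y) => /(_ _).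
have -> : rad + 1 <= c + lam i * (2 / eps) by lra.
move=> /(_ isT) IHy.
have xB : `|x| <= B by lra.
have := energy i xB; rewrite -/y => en.
have : `|dot (a i - q) (y - x)| <= n%:R * (eta * (2 * B)).
  apply: (le_trans (norm_dot_le _ _)); rewrite ler_wpM2l // ler_pM // ?aq //.
  by apply: (le_trans (ler_normB _ _)); lra.
rewrite mul1r ler_norml => /andP[_].
rewrite dotBl !(dotDr _ (- x)) -!(scaleN1r x) !dotZr.
set Z := \sum_(_ <- _) _ in IHy *; set W := n%:R * _.
by lra.
Qed.

End Chain.

Lemma continuous_chain (R : realType) (n : nat) (T : topologicalType) (I : Type)
    (g : 'rV[R]_n -> 'rV[R]_n) (m : I -> nat) (a : I -> 'rV[R]_n)
    (lam : T -> I -> R) (s : seq I) (x : T -> 'rV[R]_n) :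
  continuous g -> (forall i y, a i != g y) ->
  (forall i, continuous (fun t => lam t i)) -> continuous x ->
  continuous (fun t => chain g m a (lam t) s (x t)).
Proof.
move=> cg ag clam; elim: s x => [//|i s IH] x cx /=.
apply: (IH (fun t => phase g (m i) (a i) (lam t i) (x t))).
by apply: continuous_phase.
Qed.

(** The plateau of radius [d] ensures that where the nodes [c] are [d]-dense, one
    of the bumps is 1, which bounds the total time of a chain from below. *)
Definition bump {R : realType} {n : nat} (d : R) (c q : 'rV[R]_n) : R :=
  Num.max 0 (Num.min 1 (2 - `|c - q| / d)).

Lemma continuous_bump (R : realType) (n : nat) (T : topologicalType)
    (d k : R) (c : 'rV[R]_n) (x : T -> 'rV[R]_n) :
  continuous x -> continuous (fun t => bump d c (x t) * k).
Proof.
move=> cx t; apply: cvgM; last exact: cvg_cst.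
apply: (@continuous_max R T (fun=> 0)); first exact: cvg_cst.
apply: (@continuous_min R T (fun=> 1)); first exact: cvg_cst.
apply: cvgB; first exact: cvg_cst.
apply: cvgM; last exact: cvg_cst.
exact: (continuous_norm (continuous_cstB cx)).
Qed.

Section Core.
Context {R : realType} {n : nat}.
Variables (g : 'rV[R]_n -> 'rV[R]_n) (f : 'rV[R]_n -> R) (eps rad : R).
Hypothesis cg : continuous g.
Hypothesis mvt : forall x v : 'rV[R]_n, exists2 t : R, 0 <= t <= 1 &
  f (x + v) - f x = dot (g (x + t *: v)) v.
Hypotheses (eps0 : 0 < eps) (rad0 : 0 <= rad).
Hypothesis far : forall x, rad <= `|x| -> eps <= `|g x|.
Hypothesis g0 : g 0 = 0.

(** If the range contained no such ball, the omitted values would be dense in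
    the ball of radius [eps]. Phases for omitted values near the nodes of a
    grid, weighted by bumps around the nodes, are then chained into a
    continuous map [X] on the cube of radius [rho], with
    [f (X q) - dot q (X q) < f 0] everywhere and [X q] pointing outwards on
    the faces; the latter gives a zero of [X], which the former excludes. *)
Theorem range_has_ball : exists a eta, [/\ `|a| < eps, 0 < eta &
  forall b, `|b - a| < eta -> exists x, g x = b].
Proof.
apply: contrapT => nball.
have dense a eta : `|a| < eps -> 0 < eta ->
    exists b, `|b - a| < eta /\ forall x, b != g x.
  move=> aeps eta0; apply: contrapT => nb; apply: nball; exists a, eta; split=> // b ba.
  apply: contrapT => nx; apply: nb; exists b; split=> // x.
  by apply/eqP => bx; apply: nx; exists x.
pose rho := eps / 4; have rho0 : 0 < rho by rewrite divr_gt0.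
have [r0 r00 gr0] := uniformly_continuous_ball 0 cg (divr_gt0 rho0 (ltr0Sn R 3)).
pose r := r0 / 2; have r_gt0 : 0 < r by rewrite divr_gt0.
have gr y : `|y| <= r -> `|g y| <= rho / 4.
  move=> yr; have := gr0 0 y; rewrite g0 !subr0 normr0 => /(_ (lexx _)) H.
  by apply/ltW/H; apply: le_lt_trans yr _; rewrite /r; lra.
pose N : R := (4 ^ n)%:R; have N0 : 0 < N by rewrite ltr0n expn_gt0.
(* The time is so short that on the faces of the cube the chain, of speed at
   most [2 / rho], does not leave the ball of radius [r]. *)
pose T := r * rho / (2 * N).
have T0 : 0 < T by rewrite divr_gt0 ?mulr_gt0.
have NT : N * T * (2 / rho) = r by rewrite /T; field; rewrite !gt_eqF.
pose B := rad + 1 + N * T * (2 / eps).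
have NTe : 0 < N * T * (2 / eps).
  by apply: mulr_gt0; [exact: mulr_gt0|exact: divr_gt0].
have radB : rad + 1 <= B by rewrite lerDl ltW.
have B0 : 0 < B by apply: lt_le_trans radB; rewrite ltr_wpDl.
(* The mesh comes last: the total error of [N] active phases has to stay below
   the height [T / 2] that is lost. *)
pose eta := Num.min (rho / 4) (T / (8 * N * n.+1%:R * B)).
have den0 : 0 < 8 * N * n.+1%:R * B by rewrite !mulr_gt0.
have eta0 : 0 < eta by rewrite lt_min; apply/andP; split; apply: divr_gt0.
have eta_rho : eta <= rho / 4 by rewrite ge_min lexx.
have eta_T : N * (n%:R * (eta * (2 * B))) <= T / 4.
  have : eta <= T / (8 * N * n.+1%:R * B) by rewrite ge_min lexx orbT.
  rewrite ler_pdivlMr // => le1.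
  apply: (@le_trans _ _ (eta * (8 * N * n.+1%:R * B) / 4)); last by rewrite ler_wpM2r.
  rewrite (_ : _ / 4 = N * (n.+1%:R * (eta * (2 * B)))); last by field.
  rewrite ler_wpM2l ?(ltW N0) // ler_wpM2r ?ler_nat //.
  by rewrite !mulr_ge0 // ltW.
have [I [c [d [/andP[d0 ds] crho ccov cmult]]]] :=
  @grid_cover R n rho (eta / 3) rho0 (divr_gt0 eta0 (ltr0Sn R 2)).
have /choice[a ha] : forall i, exists b, `|b - c i| < d /\ forall x, b != g x.
  move=> i; apply: dense => //; apply: le_lt_trans (crho i) _.
  by move: (eps0); rewrite /rho; lra.
have ag i x : a i != g x by case: (ha i).
have aeps i : `|a i| <= eps / 2.
  have [ac _] := ha i; rewrite -(subrK (c i) (a i)).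
  apply: (le_trans (ler_normD _ _)); have := crho i; rewrite /rho in rho0 eta_rho *; lra.
have /choice[m hm] : forall i, exists m, (0 < m)%N /\ forall t, 0 <= t <= T ->
    (forall x c, rad + 1 <= c -> `|x| <= c ->
      `|phase g m (a i) t x| <= c + t * (2 / eps)) /\
    (forall x, `|x| <= B ->
      f (phase g m (a i) t x) - dot (a i) (phase g m (a i) t x)
        <= f x - dot (a i) x - t / 2).
  move=> i; have [m m0 H] := phase_exists cg mvt eps0 rad0 far (aeps i) (ag i) T0 radB.
  by exists m; split.
pose lam q i := bump d (c i) q * T.
have bump_ge0 i q : 0 <= bump d (c i) q by rewrite le_max lexx.
have bump_le1 i q : bump d (c i) q <= 1.
  by rewrite ge_max ler01 /= ge_min lexx.
have lam0 q i : 0 <= lam q i by rewrite mulr_ge0 // ltW.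
have lamT q i : 0 <= lam q i <= T by rewrite lam0 /= ler_piMl ?bump_le1 // ltW.
have active q i : lam q i != 0 -> `|q - c i| < 2 * d.
  apply: contraNT; rewrite -leNgt distrC => qc.
  rewrite /lam /bump max_l ?mul0r // ge_min; apply/orP; right.
  by rewrite subr_le0 ler_pdivlMr.
have near_a q i : lam q i != 0 -> `|a i - q| <= eta.
  move=> /active qc; have [ac _] := ha i.
  rewrite (_ : a i - q = (a i - c i) - (q - c i)); last by rewrite opprB addrA subrK.
  by apply: (le_trans (ler_normB _ _)); lra.
pose S q := \sum_(i <- enum I) (lam q i != 0)%:R : R.
have SN q : S q <= N.
  rewrite /S big_enum /= -natr_sum ler_nat.
  rewrite (eq_bigr (fun i => if (lam q i != 0)%R then 1%N else 0%N)); last first.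
    by move=> i _; case: (_ != 0).
  rewrite -big_mkcond sum1_card.
  apply: leq_trans (cmult q); apply: subset_leq_card; apply/fintype.subsetP => i.
  by rewrite !inE; apply: active.
have total_le q : total_time (lam q) (enum I) <= N * T.
  apply: (@le_trans _ _ (S q * T)); last by rewrite ler_wpM2r // ltW.
  rewrite mulr_suml; apply: ler_sum => i _.
  have [->|_] := eqVneq (lam q i) 0; first by rewrite mul0r.
  by rewrite mul1r; case/andP: (lamT q i).
have total_ge q : `|q| <= rho -> T <= total_time (lam q) (enum I).
  move=> /ccov[i qi]; rewrite /total_time big_enum /= (bigD1 i) //=.
  rewrite -[leLHS]addr0; apply: lerD; last by apply: sumr_ge0.
  rewrite /lam ler_peMl ?(ltW T0) // le_max le_min lexx /=.
  apply/orP; right; suff : `|c i - q| / d <= 1 by lra.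
  by rewrite ler_pdivrMr // mul1r distrC.
pose X q := chain g m a (lam q) (enum I) 0.
have cX : continuous X.
  apply: continuous_chain => //; last exact: cst_continuous.
  by move=> i; apply: (@continuous_bump R n _ d T (c i) id) => q; apply: cvg_id.
have Xloc (q : 'rV[R]_n) : `|q| = rho -> (forall j, q 0 j = rho -> 0 <= X q 0 j) /\
    (forall j, q 0 j = - rho -> X q 0 j <= 0).
  move=> qrho.
  have [|||j1 j2] :=
    @chain_local R n g I m a (lam q) (lam0 q) rho r q (enum I) 0 rho0 _ gr qrho.
  - by move=> i; case: (hm i).
  - by move=> i /near_a /le_trans; apply.
  - rewrite normr0 add0r -NT ler_wpM2r ?total_le //.
    by rewrite divr_ge0 // ltW.
  by split=> j qj; [have := j1 j qj|have := j2 j qj]; rewrite mxE.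
have [||q qrho Xq] := @poincare_miranda R n X rho rho0 cX.
- move=> q j qrho qj; apply: (Xloc q _).1 => //; apply/eqP; rewrite eq_le qrho /=.
  by have := coord_le_norm q j; rewrite qj gtr0_norm.
- move=> q j qrho qj; apply: (Xloc q _).2 => //; apply/eqP; rewrite eq_le qrho /=.
  by have := coord_le_norm q j; rewrite qj normrN gtr0_norm.
have :=
  @chain_energy R n g I m a (lam q) (lam0 q) f eps rad B eps0 _ _ eta q (enum I) 0 (rad + 1).
move=> /(_ _)/(_ _)/(_ (@near_a q) (lexx _)).
rewrite -/(X q) Xq -mulr_suml -/(S q) => H.
have : f 0 - dot q 0 <= f 0 - dot q 0 - total_time (lam q) (enum I) / 2
    + S q * (n%:R * (eta * (2 * B))).
  apply: H.
  - by move=> i x c' ; have [_ /(_ _ (lamT q i))[H _]] := hm i; apply: H.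
  - by move=> i x; have [_ /(_ _ (lamT q i))[_ H]] := hm i; apply: H.
  - by rewrite normr0 addr_ge0.
  - by rewrite lerD2l ler_wpM2r ?total_le // divr_ge0 // ltW.
have : S q * (n%:R * (eta * (2 * B))) <= N * (n%:R * (eta * (2 * B))).
  by rewrite ler_wpM2r // !mulr_ge0 // ltW.
have := total_ge q qrho.
by lra.
Qed.

End Core.

(** * Gradients *)

Lemma derive_gradient (R : realType) (n : nat) (f : 'rV[R]_n -> R) (x v : 'rV[R]_n) :
  differentiable f x -> 'D_v f x = dot (gradient f x) v.
Proof.
move=> df; rewrite deriveE // [in LHS](row_sum_delta v) linear_sum.
by apply: eq_bigr => j _; rewrite linearZ /= -deriveE // mxE mulrC.
Qed.

Lemma gradient_mean_value (R : realType) (n : nat) (f : 'rV[R]_n -> R)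
    (x v : 'rV[R]_n) : (forall y, differentiable f y) ->
  exists2 t : R, 0 <= t <= 1 & f (x + v) - f x = dot (gradient f (x + t *: v)) v.
Proof.
move=> df; pose phi (t : R) := f (x + t *: v).
have dphi (t : R) : is_derive t (1 : R) phi ('D_v f (x + t *: v)).
  have quot : (fun h : R => h^-1 *: ((phi \o shift t) (h *: 1) - phi t))
      = (fun h => h^-1 *: ((f \o shift (x + t *: v)) (h *: v) - f (x + t *: v))).
    apply/funext => h; rewrite /phi /=; congr (_ *: (f _ - _)).
    by rewrite [h *: 1]mulr1 scalerDl addrCA.
  have fv : derivable f (x + t *: v) v by apply: diff_derivable.
  apply: DeriveDef; first by rewrite /derivable quot.
  by rewrite /derive quot.
have cphi : {within `[0, 1], continuous phi}.
  by apply: derivable_within_continuous => t _; exact: ex_derive.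
have [t] :=
  @MVT R phi (fun t => 'D_v f (x + t *: v)) 0 1 ltr01 (fun t _ => dphi t) cphi.
rewrite in_itv /= => /andP[t0 t1].
rewrite /phi scale1r scale0r addr0 subr0 mulr1 => ->.
by exists t; rewrite ?derive_gradient // !ltW.
Qed.

Lemma norm_le_eucl (R : realType) (n : nat) (x : 'rV[R]_n) : `|x| <= eucl_norm x.
Proof.
have -> : eucl_norm x = Num.sqrt (dot x x).
  by congr Num.sqrt; apply: eq_bigr => j _; rewrite expr2.
by rewrite -[leLHS]normr_id -sqrtr_sqr ler_wsqrtr ?dot_self_ge.
Qed.

Lemma continuous_translate (R : realType) (n : nat) (T : topologicalType)
    (g : 'rV[R]_n -> 'rV[R]_n) (x0 : 'rV[R]_n) (x : T -> 'rV[R]_n) :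
  continuous g -> continuous x -> continuous (fun t => g (x0 + x t) - g x0).
Proof.
move=> cg cx t; apply: cvgB; last exact: cvg_cst.
have cy : continuous (fun t => x0 + x t).
  by move=> u; apply: cvgD; [exact: cvg_cst|exact: cx].
have gy := @continuous_comp _ _ _ (fun t => x0 + x t) g t (cy t).
by apply: gy; apply: cg.
Qed.

Lemma notin_closure_dist (R : realType) (n : nat) (A : set 'rV[R]_n) (p : 'rV[R]_n) :
  ~ closure A p -> exists2 e : R, 0 < e & forall y, A y -> e <= `|y - p|.
Proof.
move=> nA; apply: contrapT => nexists; apply: nA => U /nbhs_ballP[e /= e0 eU].
apply: contrapT => AU; apply: nexists; exists e => // y Ay.
rewrite leNgt; apply/negP => yp; apply: AU; exists y; split=> //; apply: eU.
by rewrite -ball_normE /= distrC.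
Qed.

Theorem theorem1p2 (R : realType) (n : nat) (hn : (1 <= n)%N)
    (f : 'rV[R]_n -> R) (hf : is_C1 f) :
  closure (gradient_range f) =
  closure (interior (gradient_range f)) `|` asymptotic_values f.
Proof.
have [df cg] := hf; set g := gradient f in cg *.
apply/seteqP; split; last first.
  move=> p [|/(_ 1 ltr01)]; first exact: (closureS (@interior_subset _ _)).
  by apply: closureS => _ [x _ <-]; exists x.
move=> p Gp; apply: contrapT => /not_orP[nint nasy].
have [e1 e10 inte1] := notin_closure_dist nint.
have [r r0 [e2 e20 fare2]] : exists2 r : R, 0 < r & exists2 e2 : R, 0 < e2 &
    forall x, r <= `|x| -> e2 <= `|g x - p|.
  apply: contrapT => nr; apply: nasy => r r0.
  apply: contrapT => /notin_closure_dist[e e0 ge].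
  apply: nr; exists r => //; exists e => // x rx; apply: ge; exists x => //=.
  exact: le_trans rx (norm_le_eucl x).
(* Recentre at a point [x0] whose gradient is close to [p]; halving [e] keeps
   the ball around [g x0] inside the one around [p]. *)
pose e := Num.min e1 e2; have e0 : 0 < e by rewrite lt_min e10.
have [ee1 ee2] : e <= e1 /\ e <= e2 by rewrite /e !ge_min !lexx orbT.
have [x0 gx0] : exists x0, `|g x0 - p| < e / 2.
  have [_ [[x0 _ <-] pB]] := Gp _ (nbhsx_ballx p (e / 2) (divr_gt0 e0 (ltr0Sn R 1))).
  by exists x0; move: pB; rewrite -ball_normE /= distrC.
pose G x := g (x0 + x) - g x0.
pose F x := f (x0 + x) - dot (g x0) x.
have cG : continuous G.
  by apply: (@continuous_translate R n _ g x0 id cg) => x; apply: cvg_id.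
have mvt (x v : 'rV[R]_n) : exists2 t : R, 0 <= t <= 1 &
    F (x + v) - F x = dot (G (x + t *: v)) v.
  have [t t01 ft] := gradient_mean_value (x0 + x) v df.
  by exists t => //; rewrite /F /G dotDr dotBl [x0 + _]addrA [x0 + (_ + _)]addrA -ft; ring.
have far x : r + `|x0| <= `|x| -> e / 2 <= `|G x|.
  move=> xr.
  have : r <= `|x0 + x|.
    by have := ler_normB (x0 + x) x0; rewrite addrC addKr; lra.
  move=> /fare2 gx.
  have := ler_normD (G x) (g x0 - p); rewrite /G addrA subrK; lra.
have [|||a [eta [ae eta0 ball_range]]] :=
  @range_has_ball R n G F (e / 2) (r + `|x0|) cG mvt _ _ far.
- by rewrite divr_gt0.
- by rewrite addr_ge0 // ltW.
- by rewrite /G addr0 subrr.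
have : interior (gradient_range f) (g x0 + a).
  apply/nbhs_ballP; exists eta => //= b; rewrite -ball_normE /= distrC => bb.
  have [|x Gx] := ball_range (b - g x0); first by rewrite -addrA -opprD.
  by exists (x0 + x) => //; rewrite -/g -[RHS](subrK (g x0)) -Gx /G subrK.
move=> /inte1; have := ler_normD (g x0 - p) a; rewrite addrAC; lra.
Qed.
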